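(* Let $\mathcal{M}$ be a uniquely geodesic Riemannian manifold with sectional curvature in $[\kappa_{\min},\kappa_{\max}]$ and let $\mathcal{X}\subset\mathcal{M}$ be closed and g-convex. Let $f\in\mathcal{F}_L(\mathcal{X})$ and $g\in\Gamma(\mathcal{X})$ be such that $F = f+g$ is $\mu$-strongly g-convex in $\mathcal{X}$, and let $x^*=\arg\min_{x\in\mathcal{X}}F(x)$. Then, starting from $x_0\in\mathcal{X}$ and iterating the rule $$x_{t+1}\in\arg\min_{y\in\mathcal{X}}\Big\{\langle\nabla f(x_t),\mathrm{Exp}_{x_t}^{-1}(y)\rangle+\frac{L}{2}\mathrm{dist}(x_t,y)^2+g(y)\Big\},$$ one gets, for every $\epsilon>0$, an $\epsilon$-minimizer of $F$ (a point $x\in\mathcal X$ with $F(x)-F(x^* )\le\epsilon$) in $O\big(\frac{L}{\mu}\log\big(\frac{F(x_0)-F(x^* )}{\epsilon}\big)\big)$ iterations.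
   Context: A space is uniquely geodesic if every two points are connected by one and only one geodesic. $\mathrm{Exp}_x^{-1}$ is the inverse of the Riemannian exponential map. A set is g-convex if every two of its points are joined by a geodesic contained in it. For a g-convex set $\mathcal{X}\subset\mathcal{M}$: $\Gamma(\mathcal{X})$ is the class of functions $\mathcal{M}\to\mathbb{R}\cup\{+\infty\}$ that are proper, lower semicontinuous and g-convex in $\mathcal{X}$ (convex along every geodesic in $\mathcal{X}$); $\mathcal{F}_L(\mathcal{X})\subset\Gamma(\mathcal{X})$ is the subclass of functions that are differentiable in an open set containing $\mathcal{X}$ and satisfy $f(y)-f(x)-\langle\nabla f(x),\mathrm{Exp}_x^{-1}(y)\rangle\le\frac L2\mathrm{dist}(x,y)^2$ for all $x,y\in\mathcal{X}$. A function $F$ is $\mu$-strongly g-convex in $\mathcal{X}$ ($\mu>0$) if for every geodesic $\gamma:[0,1]\to\mathcal{X}$ (constant speed) from $x$ to $y$ and $s\in[0,1]$, $F(\gamma(s))\le(1-s)F(x)+sF(y)-\frac{\mu}{2}s(1-s)\mathrm{dist}(x,y)^2$. $O(\cdot)$ hides universal constants only.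
   Formalization: The factor L/μ is replaced by max(1, L/μ) with L > 0, since the bound as written fails for L much smaller than μ (f = 0, g = μ|x|²/2 on Euclidean space); for μ ≤ L it is the stated bound. *)

(* Defs.v *)
(* MathComp-Analysis *)
From HB Require Import structures.
From mathcomp Require Import all_boot all_order all_algebra.
From mathcomp Require Import all_classical all_reals all_analysis.

Set Implicit Arguments.
Unset Strict Implicit.
Unset Printing Implicit Defensive.

Import Order.TTheory GRing.Theory Num.Theory.
Import numFieldNormedType.Exports.

Local Open Scope classical_set_scope.
Local Open Scope ring_scope.

Definition partial (R : realType) (n : nat) (W : normedModType R)
    (i : 'I_n) (f : 'rV[R]_n -> W) : 'rV[R]_n -> W :=
  fun u => 'D_(delta_mx 0 i) f u.

(* For U open: f is of class C^oo on U. *)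
Definition smooth_on (R : realType) (n : nat) (W : normedModType R)
    (U : set 'rV[R]_n) (f : 'rV[R]_n -> W) : Prop :=
  forall (s : seq 'I_n) (u : 'rV[R]_n), U u ->
    differentiable (foldr (fun i g => partial i g) f s) u.

(* A smooth n-manifold without boundary, with a smooth atlas indexed by the
   points: chart p is (dom p, coord p), it contains p, and coordV p inverts it.
   Indexing by points loses no generality: any smooth atlas contains a subatlas
   obtained by selecting one chart around each point.  The functions coord p and
   coordV p are total, their values off dom p and off its image are junk.
   The tangent space at x is 'rV[R]_n, through the chart at x. *)
Record smoothManifold (R : realType) (n : nat) := SmoothManifold {
  point :> topologicalType;
  dom : point -> set point;
  coord : point -> point -> 'rV[R]_n;
  coordV : point -> 'rV[R]_n -> point;
  _ : hausdorff_space point;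
  _ : @second_countable point;
  _ : forall p, open (dom p);
  _ : forall p, dom p p;
  _ : forall p, open (coord p @` dom p);
  _ : forall p q, dom p q -> coordV p (coord p q) = q;
  _ : forall p q, dom p q -> {for q, continuous (coord p)};
  _ : forall p q, dom p q -> {for coord p q, continuous (coordV p)};
  _ : forall p q,
      smooth_on (coord p @` (dom p `&` dom q)) (coord q \o coordV p) }.

(* The matrix, in the chart p and at the coordinates u, of the family of
   bilinear forms whose matrix on T_xM (in the chart at x) is G x. *)
Definition chart_form (R : realType) (n : nat) (M : smoothManifold R n)
    (G : M -> 'M[R]_n) (p : M) (u : 'rV[R]_n) : 'M[R]_n :=
  let q := coordV p u in
  let J := 'J (coord q \o coordV p) u in
  J *m G q *m J^T.

Record riemannianManifold (R : realType) (n : nat) := RiemannianManifold {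
  manifold :> smoothManifold R n;
  metric : manifold -> 'M[R]_n;
  _ : forall x, (metric x)^T = metric x;
  _ : forall x (v : 'rV[R]_n), v != 0 -> 0 < (v *m metric x *m v^T) 0 0;
  _ : forall p : manifold, smooth_on (coord p @` dom p) (chart_form metric p) }.

Section Riemannian.
Context {R : realType} {n : nat} (M : riemannianManifold R n).

Definition inner (x : M) (v w : 'rV[R]_n) : R := (v *m metric x *m w^T) 0 0.

(* Meant for I open: near a time of I, c stays in dom p, so that the iterated
   derivatives genuinely exist there. *)
Definition smooth_curve (I : set R) (c : R -> M) : Prop :=
  forall t, I t -> {for t, continuous c} /\
    forall p : M, dom p (c t) ->
      forall k, derivable (derive1n k (coord p \o c)) t 1.

Definition velocity (c : R -> M) (t : R) : 'rV[R]_n :=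
  derive1 (coord (c t) \o c) t.

Definition speed (c : R -> M) (t : R) : R :=
  Num.sqrt (inner (c t) (velocity c t) (velocity c t)).

(* path_length x y l: some piecewise smooth curve from x to y has length l. *)
Inductive path_length : M -> M -> R -> Prop :=
| path_smooth (I : set R) (c : R -> M) :
    open I -> `[0, 1]%classic `<=` I -> smooth_curve I c ->
    path_length (c 0) (c 1) (\int[lebesgue_measure]_(t in `[0, 1]) speed c t)
| path_cat (x y z : M) (l m : R) :
    path_length x y l -> path_length y z m -> path_length x z (l + m).

Definition dist (x y : M) : R := inf [set l | path_length x y l].

Definition christoffel (p : M) (k i j : 'I_n) (u : 'rV[R]_n) : R :=
  let g a b := fun w : 'rV[R]_n => chart_form (@metric _ _ M) p w a b in
  2^-1 * \sum_l invmx (chart_form (@metric _ _ M) p u) k l *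
    (partial i (g j l) u + partial j (g i l) u - partial l (g i j) u).

(* R(d_i, d_j) d_k = \sum_l riemann p l i j k d_l,
   for R(U, V) = [nabla_U, nabla_V] - nabla_[U, V]. *)
Definition riemann (p : M) (l i j k : 'I_n) (u : 'rV[R]_n) : R :=
  partial i (christoffel p l j k) u - partial j (christoffel p l i k) u +
  \sum_m (christoffel p m j k u * christoffel p l i m u -
          christoffel p m i k u * christoffel p l j m u).

Definition curvature (x : M) (v w z : 'rV[R]_n) : 'rV[R]_n :=
  \row_l \sum_i \sum_j \sum_k
    v 0 i * w 0 j * z 0 k * riemann x l i j k (coord x x).

Definition sectional_curvature (x : M) (v w : 'rV[R]_n) : R :=
  inner x (curvature x v w w) v /
  (inner x v v * inner x w w - inner x v w ^+ 2).

Definition sectional_curvature_in (kmin kmax : R) : Prop :=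
  forall (x : M) (v w : 'rV[R]_n), row_free (col_mx v w) ->
    kmin <= sectional_curvature x v w <= kmax.

(* Constant speed, distance realizing smooth curve [0, 1] -> M; smoothness on
   the closed interval is that of an extension to an open neighbourhood, and
   only the values on [0, 1] matter. *)
Definition geodesic (c : R -> M) : Prop :=
  (exists2 I : set R, open I /\ `[0, 1]%classic `<=` I & smooth_curve I c) /\
  forall s t : R, s \in `[0, 1] -> t \in `[0, 1] ->
    dist (c s) (c t) = `|s - t| * dist (c 0) (c 1).

Definition geodesic_from_to (x y : M) (c : R -> M) : Prop :=
  [/\ geodesic c, c 0 = x & c 1 = y].

Definition uniquely_geodesic : Prop :=
  forall x y : M, exists2 c, geodesic_from_to x y c &
    forall c', geodesic_from_to x y c' -> {in `[0, 1], c' =1 c}.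

(* Graph of the (partial) exponential map: Exp_x(v) = y when the geodesic issued
   from x with velocity v is at y at time 1. *)
Definition is_Exp (x : M) (v : 'rV[R]_n) (y : M) : Prop :=
  exists2 c, geodesic_from_to x y c & velocity c 0 = v.

Definition Exp_inv (x y : M) : 'rV[R]_n := xget 0 [set v | is_Exp x v y].

Definition contained (c : R -> M) (X : set M) : Prop :=
  forall s : R, s \in `[0, 1] -> X (c s).

Definition gconvex_set (X : set M) : Prop :=
  forall x y, X x -> X y ->
    exists2 c, geodesic_from_to x y c & contained c X.

Definition proper_on (X : set M) (f : M -> \bar R) : Prop :=
  (forall x, f x != -oo%E) /\ exists2 x, X x & f x != +oo%E.

Definition gconvex_on (X : set M) (f : M -> \bar R) : Prop :=
  forall c, geodesic c -> contained c X -> forall s : R, s \in `[0, 1] ->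
    (f (c s) <= (1 - s)%:E * f (c 0%R) + s%:E * f (c 1%R))%E.

Definition strongly_gconvex_on (mu : R) (X : set M) (f : M -> \bar R) : Prop :=
  forall c, geodesic c -> contained c X -> forall s : R, s \in `[0, 1] ->
    (f (c s) <= (1 - s)%:E * f (c 0%R) + s%:E * f (c 1%R)
       - (mu / 2 * s * (1 - s) * dist (c 0) (c 1) ^+ 2)%:E)%E.

Definition Gamma (X : set M) (f : M -> \bar R) : Prop :=
  [/\ proper_on X f,
      lower_semicontinuous (f : subspace X -> \bar R) &
      gconvex_on X f].

Definition local_expr (f : M -> \bar R) (x : M) (u : 'rV[R]_n) : R :=
  fine (f (coordV x u)).

Definition differentiable_on (U : set M) (f : M -> \bar R) : Prop :=
  forall x, U x -> f x \is a fin_num /\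
    differentiable (local_expr f x) (coord x x).

(* The Riesz representative of df_x: inner x (grad f x) v = df_x(v). *)
Definition grad (f : M -> \bar R) (x : M) : 'rV[R]_n :=
  (\row_i partial i (local_expr f x) (coord x x)) *m invmx (metric x).

Definition smooth_class (L : R) (X : set M) (f : M -> \bar R) : Prop :=
  [/\ Gamma X f,
      exists U : set M, [/\ open U, X `<=` U & differentiable_on U f] &
      forall x y, X x -> X y ->
        fine (f y) - fine (f x) - inner x (grad f x) (Exp_inv x y)
          <= L / 2 * dist x y ^+ 2].

Definition is_argmin (X : set M) (h : M -> \bar R) (x : M) : Prop :=
  X x /\ forall y, X y -> (h x <= h y)%E.

Definition composite_model (L : R) (f g : M -> \bar R) (x y : M) : \bar R :=
  ((inner x (grad f x) (Exp_inv x y) + L / 2 * dist x y ^+ 2)%:E + g y)%E.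

End Riemannian.

(* Main.v *)
Require Import Defs.
From HB Require Import structures.
From mathcomp Require Import all_boot all_order all_algebra.
From mathcomp Require Import all_classical all_reals all_analysis.
From mathcomp Require Import ring lra.

(** Since f is g-convex, its first-order model at x_t lies below f on X, so the
    definition of x_{t+1} and L-smoothness give
    F(x_{t+1}) <= F(y) + L/2 dist(x_t, y)^2 for every y in X.
    Taking y at time s = mu / (L + mu) on the geodesic from x_t to xs, the
    strong convexity term -mu/2 s (1 - s) dist(x_t, xs)^2 cancels the quadratic
    L/2 s^2 dist(x_t, xs)^2 exactly, so the gap F(x_t) - F(xs) is multiplied by
    at most 1 - s = L / (L + mu) <= exp(- s) at each step. *)

Set Implicit Arguments.
Unset Strict Implicit.
Unset Printing Implicit Defensive.

Import Order.TTheory GRing.Theory Num.Theory.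
Import numFieldNormedType.Exports.

Local Open Scope classical_set_scope.
Local Open Scope ring_scope.

(** The two-sided difference quotient converges, so its limit can be computed along [0^'+] alone.
    One side is all that is available later: convexity along a geodesic bounds slopes only for times
    in [0, 1]. *)
Lemma derive1_le_of_right_slope (R : realType) (h : R -> R) (a k : R) :
  derivable h a 1 -> (\forall s \near 0^'+, h (a + s) - h a <= s * k) ->
  derive1 h a <= k.
Proof.
move=> dh hk; rewrite derive1E.
have right_dnbhs : (0 : R)^'+ `=>` 0^'.
  by move=> A [e e0 eA]; exists e => // u ue u0; apply: eA => //; rewrite gt_eqF.
have dh' := cvg_trans (cvg_app _ right_dnbhs) dh.
apply: (ler_cvg_to dh' (cvg_cst k)).
near=> s; have s0 : 0 < s by near: s; exact: nbhs_right_gt.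
rewrite [_ *: _]mulrC ler_pdivrMr// [s *: 1]mulr1 /= [s + a]addrC [k * s]mulrC.
by near: s.
Unshelve. all: by end_near. Qed.

Section SmoothManifold.
Context {R : realType} {n : nat} {M : smoothManifold R n}.
Implicit Types p q : M.

Lemma open_dom p : open (dom p).
Proof. by case: M p. Qed.

Lemma dom_refl p : dom p p.
Proof. by case: M p. Qed.

Lemma coordVK p q : dom p q -> coordV p (Defs.coord p q) = q.
Proof. by case: M p q. Qed.

End SmoothManifold.

(** * Gradients, geodesics and the first-order lower bound *)

Section Riemannian.
Context {R : realType} {n : nat} {M : riemannianManifold R n}.
Implicit Types (x y : M) (v w : 'rV[R]_n).

Lemma metric_unitmx x : metric x \in unitmx.
Proof.
have pos w : w != 0 -> 0 < (w *m metric x *m w^T) 0 0 by case: M x w.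
rewrite -row_free_unit; apply: inj_row_free => w wG0.
by apply/eqP/contraT => /pos; rewrite wG0 mul0mx mxE ltxx.
Qed.

Lemma inner_grad (f : M -> \bar R) x v :
  differentiable (local_expr f x) (Defs.coord x x) ->
  inner x (grad f x) v = 'd (local_expr f x) (Defs.coord x x) v.
Proof.
move=> df; rewrite /inner /grad mulmxKV ?metric_unitmx//.
rewrite [v in RHS]row_sum_delta linear_sum mxE.
apply: eq_bigr => i _; rewrite linearZ/= !mxE /partial deriveE//.
by rewrite mulrC.
Qed.

(** Chain rule in the chart at [c 0]. The last clause is only local, because [coordV] inverts
    [coord] only while the curve stays in the chart domain. *)
Lemma derive1_along_curve (f : M -> \bar R) (I : set R) (c : R -> M) :
  I 0 -> smooth_curve I c ->
  differentiable (local_expr f (c 0)) (Defs.coord (c 0) (c 0)) ->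
  let h := local_expr f (c 0) \o (Defs.coord (c 0) \o c) in
  [/\ derivable h 0 1,
      derive1 h 0 = inner (c 0) (grad f (c 0)) (velocity c 0) &
      \forall s \near nbhs 0, h s = fine (f (c s))].
Proof.
move=> I0 cI df h; have [cc0 cd] := cI _ I0.
have domc0 := @dom_refl _ _ M (c 0).
have /derivable1_diffP dc := cd _ domc0 0%N.
have dh : differentiable h 0 by exact: differentiable_comp.
split; first exact/derivable1_diffP.
  rewrite derive1E deriveE// /h diff_comp//= inner_grad// /velocity.
  by rewrite diff1E// /= scale1r.
have : \forall s \near nbhs 0, dom (c 0) (c s).
  by apply: cc0; exact: open_nbhs_nbhs (conj (open_dom _) domc0).
by apply: filterS => s ds; rewrite /h /= /local_expr coordVK.
Qed.
(** The g-convexity of [X] provides one geodesic inside [X]; by uniqueness, any other one with the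
    same endpoints agrees with it on [0, 1]. *)
Lemma uniquely_geodesic_contained (X : set M) x y (c : R -> M) :
  uniquely_geodesic M -> gconvex_set X -> X x -> X y ->
  geodesic_from_to x y c -> contained c X.
Proof.
move=> uM gX Xx Xy cxy; have [c' c'xy c'X] := gX _ _ Xx Xy.
have [c'' _ uniq] := uM x y.
by move=> s s01; rewrite (uniq _ cxy)// -(uniq _ c'xy)//; exact: c'X.
Qed.

Lemma Exp_invP x y : uniquely_geodesic M -> is_Exp x (Exp_inv x y) y.
Proof.
move=> uM; have [c cxy _] := uM x y.
(* Since a geodesic exists, [xget] picks a genuine element and not its default 0. *)
by apply: (@xgetPex _ 0 [set v | is_Exp x v y]); exists (velocity c 0), c.
Qed.

(** Along the geodesic with initial velocity [Exp_inv x y], f is a convex function of time: its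
    slopes from 0 are at most f(y) - f(x), and its derivative at 0 is the gradient term. *)
Lemma gconvex_grad_le (X : set M) (f : M -> \bar R) x y :
  uniquely_geodesic M -> gconvex_set X -> gconvex_on X f ->
  differentiable_on X f -> X x -> X y ->
  fine (f x) + inner x (grad f x) (Exp_inv x y) <= fine (f y).
Proof.
move=> uM gX cf df Xx Xy; have [c cxy <-] := Exp_invP x y uM.
have cX := uniquely_geodesic_contained uM gX Xx Xy cxy.
have [geoc cx cy] := cxy; have [[I [_ I01 cI]] _] := geoc.
have I0 : I 0 by apply: I01; rewrite /= in_itv/= lexx ler01.
rewrite -cx in Xx *; rewrite -cy in Xy *.
have [_ dfx] := df _ Xx.
have [dh <- hE] := derive1_along_curve I0 cI dfx.
rewrite addrC -lerBrDr; apply: derive1_le_of_right_slope => //.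
near=> s.
have s01 : s \in `[0, 1].
  by rewrite in_itv/=; apply/andP; split; near: s;
    [exact: nbhs_right_ge|exact: nbhs_right_le].
have fin p : X p -> (fine (f p))%:E = f p by move=> /df[fp _]; rewrite fineK.
rewrite add0r (nbhs_singleton hE).
have -> : (local_expr f (c 0) \o (Defs.coord (c 0) \o c)) s = fine (f (c s)).
  by near: s; exact: (cvg_at_right_filter cvg_id hE).
have := cf _ geoc cX _ s01.
rewrite -(fin _ Xx) -(fin _ Xy) -(fin _ (cX _ s01)) -!EFinM -EFinD lee_fin.
lra.
Unshelve. all: by end_near. Qed.

(** * One proximal step *)

Lemma prox_step_le (X : set M) (f g : M -> \bar R) (L : R) x x' y :
  uniquely_geodesic M -> gconvex_set X -> smooth_class L X f ->
  (forall z, g z != -oo%E) ->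
  X x -> is_argmin X (composite_model L f g x) x' -> X y ->
  (f x' + g x' <= f y + g y + (L / 2 * dist x y ^+ 2)%:E)%E.
Proof.
move=> uM gX [[_ _ cf] [U [_ XU dU]] smooth] gNy Xx [Xx' min] Xy.
have df : differentiable_on X f by move=> z /XU /dU.
have fin p : X p -> (fine (f p))%:E = f p by move=> /df[fp _]; rewrite fineK.
have up := smooth _ _ Xx Xx'.
have low := gconvex_grad_le uM gX cf df Xx Xy.
have := min _ Xy; rewrite /composite_model -(fin _ Xx') -(fin _ Xy).
move: (gNy x') (gNy y).
(* If g(y) is infinite the bound is trivial; if g(y) is finite, minimality of x' excludes g(x') =
   +oo. *)
case: (g y) => [gy| |] //; case: (g x') => [gx'| |] // _ _; rewrite ?leey//.
by rewrite -!EFinD !lee_fin; lra.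
Qed.

Lemma prox_step_contraction (X : set M) (f g : M -> \bar R) (L mu : R)
    x x' xs :
  uniquely_geodesic M -> gconvex_set X -> smooth_class L X f ->
  (forall z, g z != -oo%E) -> 0 < L -> 0 < mu ->
  strongly_gconvex_on mu X (fun y => f y + g y)%E ->
  X x -> is_argmin X (composite_model L f g x) x' -> X xs ->
  g x \is a fin_num -> g xs \is a fin_num ->
  g x' \is a fin_num /\
  fine (f x' + g x') - fine (f xs + g xs) <=
    L / (L + mu) * (fine (f x + g x) - fine (f xs + g xs)).
Proof.
move=> uM gX fL gNy L0 mu0 sF Xx minx' Xxs gx gxs.
have [_ [U [_ XU dU]] _] := fL; have [Xx' _] := minx'.
have fin p : X p -> (fine (f p))%:E = f p by move=> /XU/dU[fp _]; rewrite fineK.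
have [c cxy _] := uM x xs.
have cX := uniquely_geodesic_contained uM gX Xx Xxs cxy.
have [geoc cx cy] := cxy; have [_ distc] := geoc.
(* This s solves L s = mu (1 - s), which balances the two quadratic terms. *)
pose s := mu / (L + mu).
have Lmu0 : 0 < L + mu by rewrite addr_gt0.
have s1E : 1 - s = L / (L + mu) by rewrite /s; field; rewrite gt_eqF.
have Ls : L * s = mu * (1 - s) by rewrite s1E /s; ring.
have s0 : 0 <= s by rewrite divr_ge0// ltW.
have s01 : s \in `[0, 1].
  by rewrite in_itv/= s0 -subr_ge0 s1E divr_ge0// ltW.
have o01 : 0 \in `[0, 1 : R] by rewrite in_itv/= lexx ler01.
have dcs : dist x (c s) = s * dist x xs.
  by rewrite -cx distc// cy sub0r normrN ger0_norm// cx.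
have := prox_step_le uM gX fL gNy Xx minx' (cX _ s01).
have := sF _ geoc cX _ s01.
rewrite dcs cx cy -(fin _ Xx) -(fin _ Xxs) -(fin _ Xx') -(fin _ (cX _ s01)).
rewrite -(fineK gx) -(fineK gxs).
move: (gNy (c s)) (gNy x').
(* Finiteness propagates: strong convexity passes it from both endpoints to [c s], and the step
   inequality from [c s] to x'. *)
case: (g (c s)) => [gc| |] //; case: (g x') => [gx'| |] // _ _.
rewrite -!EFinD !lee_fin /= -s1E => hc hx'; split => //.
(* The nonlinear cancellation is stated explicitly so that the rest is linear in these products. *)
have : L * s * (s * dist x xs ^+ 2) = mu * (1 - s) * (s * dist x xs ^+ 2).
  by rewrite Ls.
by move: hc hx'; rewrite exprMn; lra.
Qed.

End Riemannian.

(** * From geometric decay to an iteration count *)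

Lemma ratio_le_expR (R : realType) (L mu : R) (t : nat) : 0 < L -> 0 < mu ->
  (L / (L + mu)) ^+ t <= expR (- (mu / (L + mu) * t%:R)).
Proof.
move=> L0 mu0; have Lmu0 : 0 < L + mu by rewrite addr_gt0.
have q0 : 0 <= L / (L + mu) by rewrite divr_ge0// ltW.
rewrite -mulNr expRM_natr lerXn2r ?nnegrE ?expR_ge0//.
have -> : L / (L + mu) = 1 + - (mu / (L + mu)) by field; rewrite gt_eqF.
exact: expR_ge1Dx.
Qed.

(** Source of the universal constant 2: L + mu <= 2 max(mu, L) = 2 mu max(1, L / mu). *)
Lemma ge1_ratio_mul_max (R : realType) (L mu : R) : 0 < L -> 0 < mu ->
  1 <= mu / (L + mu) * (2 * Num.max 1 (L / mu)).
Proof.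
move=> L0 mu0; rewrite mulrAC ler_pdivlMr ?addr_gt0// mul1r.
rewrite mulrCA maxr_pMr ?(ltW mu0)// mulr1 mulrCA divff ?gt_eqF// mulr1.
by case: (leP mu L) => ?; lra.
Qed.

Lemma geometric_decay_le (R : realType) (L mu d0 d eps : R) (t : nat) :
  0 < L -> 0 < mu -> 0 < eps -> d <= (L / (L + mu)) ^+ t * d0 ->
  ((2 * Num.max 1 (L / mu))%:E * lne (d0 / eps)%:E <= t%:R%:E)%E ->
  d <= eps.
Proof.
move=> L0 mu0 eps0 dle; have Lmu0 : 0 < L + mu by rewrite addr_gt0.
have q0 : 0 <= L / (L + mu) by rewrite divr_ge0// ltW.
have q1 : L / (L + mu) <= 1 by rewrite ler_pdivrMr// mul1r lerDl ltW.
(* The cases d0 <= 0 and 0 < d0 <= eps are settled first, as the power lies in [0, 1]. What remains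
   is d0 > eps, where the logarithm is a nonnegative real and multiplying by it preserves
   inequalities. *)
have [d00 _|d00] := leP d0 0.
  apply: le_trans dle (le_trans _ (ltW eps0)).
  by rewrite mulr_ge0_le0// exprn_ge0.
have [d0eps _|epsd0] := leP d0 eps.
  by apply: le_trans dle (le_trans _ d0eps); rewrite ler_piMl ?exprn_ile1 ?(ltW d00).
rewrite lne_EFin ?divr_gt0// -EFinM lee_fin => tge.
apply: le_trans dle _; rewrite -ler_pdivlMr//.
apply: le_trans (ratio_le_expR _ L0 mu0) _.
have -> : eps / d0 = expR (- ln (d0 / eps)).
  by rewrite expRN lnK ?posrE ?divr_gt0// invf_div.
rewrite ler_expR lerN2.
have ln0 : 0 <= ln (d0 / eps).
  by rewrite ln_ge0// ler_pdivlMr// mul1r ltW.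
apply: le_trans (ler_wpM2l _ tge); last by rewrite divr_ge0// ltW.
by rewrite mulrA ler_peMl// ge1_ratio_mul_max.
Qed.

Theorem proposition5 (R : realType) :
  exists C : R, 0 < C /\
  forall (n : nat) (M : riemannianManifold R n) (kmin kmax : R)
    (X : set M) (f g : M -> \bar R) (L mu : R) (xs x0 : M) (x : nat -> M),
  uniquely_geodesic M ->
  sectional_curvature_in M kmin kmax ->
  closed X ->
  gconvex_set X ->
  0 < L ->
  0 < mu ->
  smooth_class L X f ->
  Gamma X g ->
  let F := (fun y => f y + g y)%E in
  strongly_gconvex_on mu X F ->
  is_argmin X F xs ->
  X x0 ->
  x 0%N = x0 ->
  (forall t, is_argmin X (composite_model L f g (x t)) (x t.+1)) ->
  forall eps : R, 0 < eps ->
  forall t : nat,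
    ((C * Num.max 1 (L / mu))%:E * lne ((F x0 - F xs) * (eps^-1)%:E)
       <= t%:R%:E)%E ->
    X (x t) /\ (F (x t) - F xs <= eps%:E)%E.
Proof.
exists 2; split=> // n M kmin kmax X f g L mu xs x0 x.
move=> uM _ _ gX L0 mu0 fL [[gNy [z Xz gz]] _ _] F sF [Xxs minxs] Xx0 x0E.
move=> minx eps eps0 t; rewrite -{}x0E in Xx0 *.
have [_ [U [_ XU dU]] _] := fL.
have ffin p : X p -> f p \is a fin_num by move=> /XU /dU [].
(* Otherwise F(xs) = +oo, and minimality would make F infinite at the point z where g is finite. *)
have gxs : g xs \is a fin_num.
  rewrite fin_numE gNy; apply: contra gz => /eqP gxs.
  have := minxs _ Xz; rewrite /F gxs -(fineK (ffin _ Xxs)) -(fineK (ffin _ Xz)).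
  by case: (g z) (gNy z).
have Xx k : X (x k) by case: k => // k; case: (minx k).
have Ffin p : X p -> g p \is a fin_num -> F p = (fine (F p))%:E.
  by move=> Xp gp; rewrite fineK// fin_numD gp ffin.
(* If g is infinite at the starting point, so is the required number of iterations, and no natural t
   reaches it. *)
have [gx0 hyp|gx0] := boolP (g (x 0%N) \is a fin_num); last first.
  have Fx0 : F (x 0%N) = +oo%E.
    rewrite /F -(fineK (ffin _ Xx0)); move: gx0 (gNy (x 0%N)).
    by case: (g _).
  rewrite Fx0 (Ffin _ Xxs gxs) /= gt0_mulye ?lte_fin ?invr_gt0//= gt0_muley//.
  by rewrite lte_fin mulr_gt0// lt_max ltr01.
(* The induction carries finiteness of g along the iterates, which each contraction step
   requires. *)
have decay k : g (x k) \is a fin_num /\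
    fine (F (x k)) - fine (F xs) <=
      (L / (L + mu)) ^+ k * (fine (F (x 0%N)) - fine (F xs)).
  elim: k => [|k [gxk IH]]; first by rewrite expr0 mul1r.
  have [gxk1 step] := prox_step_contraction uM gX fL gNy L0 mu0 sF (Xx k)
    (minx k) Xxs gxk gxs.
  split=> //; apply: le_trans step _.
  by rewrite exprS -[leRHS]mulrA ler_wpM2l// divr_ge0// ltW// addr_gt0.
split; first exact: Xx.
have [gxt dt] := decay t.
rewrite (Ffin _ (Xx t) gxt) (Ffin _ Xxs gxs) -EFinB lee_fin.
apply: (geometric_decay_le L0 mu0 eps0 dt).
by move: hyp; rewrite (Ffin _ Xx0 gx0) (Ffin _ Xxs gxs) -EFinB -EFinM.
Qed.
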